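(* Let $n\ge 1$ and, for $1 \leq i \leq n$, let $\mathbb{F}_{q_i}$ be a finite field of order $q_i$. Let $\mathcal{G} \cong \Gamma\left(\prod_{i=1}^n \mathbb{F}_{q_i}\right)$. Then $\mathcal{G}$ is a $(2^n-2)$-partite graph (that is, its vertex set can be partitioned into $2^n-2$ non-empty independent partite sets) whose partite truncation with respect to these partite sets satisfies $$\hat{\mathcal{G}} \cong \Gamma\left(\prod_{i=1}^n \mathbb{Z}_2\right).$$
   Context: For a finite commutative ring $R$ with unity, the zero-divisor graph $\Gamma(R)$ is the simple graph whose vertices are the non-zero zero-divisors of $R$, two distinct vertices $u,v$ being adjacent if and only if $uv=0$. Partite truncation: if $\mathcal{G}$ is a $k$-partite graph with partite sets (independent sets partitioning the vertices) $\mathcal{V}_1,\dots,\mathcal{V}_k$, its partite truncated graph $\hat{\mathcal{G}}$ has vertices $\hat{v}_1,\dots,\hat{v}_k$, where $\hat{v}_i$ corresponds to $\mathcal{V}_i$, and distinct $\hat{v}_i,\hat{v}_j$ are adjacent in $\hat{\mathcal{G}}$ if and only if some vertex of $\mathcal{V}_i$ is adjacent in $\mathcal{G}$ to some vertex of $\mathcal{V}_j$. *)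

(* Defs.v *)
From HB Require Import structures.
From mathcomp Require Import all_boot all_algebra.

Set Implicit Arguments.
Unset Strict Implicit.
Unset Printing Implicit Defensive.

Import GRing.Theory.
Local Open Scope ring_scope.

(* MathComp puts the componentwise ring structure on non-dependent {ffun I -> R}
   only. The dependent product below is a separate name for {dffun forall i, R i},
   so that its ring product does not meet the componentwise group law that
   gproduct.v declares on {dffun forall i, gT i}. *)
Definition prod_ring (I : finType) (R : I -> finComPzRingType) : Type :=
  {dffun forall i : I, R i}.

Section ProdRing.
Variables (I : finType) (R : I -> finComPzRingType).

HB.instance Definition _ := Finite.copy (prod_ring R) {dffun forall i : I, R i}.

Implicit Types x y z : {dffun forall i : I, R i}.

Definition prod_ring_zero : {dffun forall i : I, R i} := [ffun i => 0].
Definition prod_ring_one : {dffun forall i : I, R i} := [ffun i => 1].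
Definition prod_ring_opp x : {dffun forall i : I, R i} := [ffun i => - x i].
Definition prod_ring_add x y : {dffun forall i : I, R i} :=
  [ffun i => x i + y i].
Definition prod_ring_mul x y : {dffun forall i : I, R i} :=
  [ffun i => x i * y i].

Fact prod_ring_addA : associative prod_ring_add.
Proof. by move=> x y z; apply/ffunP => i; rewrite !ffunE addrA. Qed.
Fact prod_ring_addC : commutative prod_ring_add.
Proof. by move=> x y; apply/ffunP => i; rewrite !ffunE addrC. Qed.
Fact prod_ring_add0 : left_id prod_ring_zero prod_ring_add.
Proof. by move=> x; apply/ffunP => i; rewrite !ffunE add0r. Qed.
Fact prod_ring_addN : left_inverse prod_ring_zero prod_ring_opp prod_ring_add.
Proof. by move=> x; apply/ffunP => i; rewrite !ffunE addNr. Qed.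
Fact prod_ring_mulA : associative prod_ring_mul.
Proof. by move=> x y z; apply/ffunP => i; rewrite !ffunE mulrA. Qed.
Fact prod_ring_mulC : commutative prod_ring_mul.
Proof. by move=> x y; apply/ffunP => i; rewrite !ffunE mulrC. Qed.
Fact prod_ring_mul1 : left_id prod_ring_one prod_ring_mul.
Proof. by move=> x; apply/ffunP => i; rewrite !ffunE mul1r. Qed.
Fact prod_ring_mulDl : left_distributive prod_ring_mul prod_ring_add.
Proof. by move=> x y z; apply/ffunP => i; rewrite !ffunE mulrDl. Qed.

HB.instance Definition _ := GRing.isZmodule.Build (prod_ring R)
  prod_ring_addA prod_ring_addC prod_ring_add0 prod_ring_addN.
HB.instance Definition _ := GRing.Zmodule_isComPzRing.Build (prod_ring R)
  prod_ring_mulA prod_ring_mulC prod_ring_mul1 prod_ring_mulDl.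

End ProdRing.

Record sgraph := SGraph {
  vertex :> finType;
  adj : rel vertex;
  adj_sym : symmetric adj;
  adj_irr : irreflexive adj }.

Definition graph_iso (G H : sgraph) : Prop :=
  exists2 f : G -> H, bijective f & forall u v, adj (f u) (f v) = adj u v.

Section ZeroDivisorGraph.
Variable R : finComPzRingType.

Definition zero_divisor (u : R) : bool := [exists v : R, (v != 0) && (u * v == 0)].

Definition zdvertex : finType := {u : R | (u != 0) && zero_divisor u}.

Definition zdadj (u v : zdvertex) : bool := (u != v) && (val u * val v == 0).

Fact zdadj_sym : symmetric zdadj.
Proof. by move=> u v; rewrite /zdadj eq_sym mulrC. Qed.
Fact zdadj_irr : irreflexive zdadj.
Proof. by move=> u; rewrite /zdadj eqxx. Qed.

Definition zero_divisor_graph : sgraph := SGraph zdadj_sym zdadj_irr.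

End ZeroDivisorGraph.

Section Partite.
Variables (G : sgraph) (k : nat) (V : 'I_k -> {set G}).

Definition independent (A : {set G}) : Prop :=
  forall u v, u \in A -> v \in A -> ~~ adj u v.

(* MathComp's [partition] forbids set0 among the blocks, so every V i is
   non-empty; injectivity makes the k sets V i distinct, hence disjoint. *)
Definition partite_sets : Prop :=
  [/\ injective V, partition [set V i | i : 'I_k] [set: G]
    & forall i, independent (V i)].

Definition trunc_adj (i j : 'I_k) : bool :=
  (i != j) && [exists u in V i, exists v in V j, adj u v].

Fact trunc_adj_sym : symmetric trunc_adj.
Proof.
suff H i j : trunc_adj i j -> trunc_adj j i by move=> i j; apply/idP/idP; exact: H.
rewrite /trunc_adj eq_sym => /andP[-> /exists_inP[u uV /exists_inP[v vV uv]]].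
by apply/exists_inP; exists v => //; apply/exists_inP; exists u; rewrite // adj_sym.
Qed.
Fact trunc_adj_irr : irreflexive trunc_adj.
Proof. by move=> i; rewrite /trunc_adj eqxx. Qed.

Definition partite_truncation : sgraph := SGraph trunc_adj_sym trunc_adj_irr.

End Partite.

(* Main.v *)
(* Two elements of a product of domains multiply to zero exactly when their
   supports are disjoint, so adjacency depends on supports only.  Hence the map
   sending a vertex to the 0/1 vector with the same support preserves and
   reflects adjacency and is onto the zero-divisor graph of the product of the
   Z_2, whose vertices are all 0/1 vectors except 0 and 1.  Its fibres are the
   partite sets. *)
Require Import Defs.
From mathcomp Require Import all_boot all_algebra.

Set Implicit Arguments.
Unset Strict Implicit.
Unset Printing Implicit Defensive.

Import GRing.Theory.
Local Open Scope ring_scope.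

(** The [V i] are the fibres of [phi]. A fibre is independent because [H] has no loops, and one edge
    between two fibres forces all edges between them, since [phi] preserves and reflects
    adjacency. *)
Lemma partite_of_surjection (G H : sgraph) (k : nat) (phi : G -> H) :
    #|H| = k -> (forall y, exists x, phi x = y) ->
    (forall u v, adj (phi u) (phi v) = adj u v) ->
  exists V : 'I_k -> {set G},
    partite_sets V /\ graph_iso (partite_truncation V) H.
Proof.
move=> cardH phi_surj phi_adj; case: k / cardH.
pose V (i : 'I_#|H|) := [set x | phi x == enum_val i].
(* Surjectivity enters only here; non-empty fibres give injectivity of [V], exclude [set0] as a
   block, and supply representatives for edges. *)
have V_n0 i : exists x, x \in V i.
  by have [x phix] := phi_surj (enum_val i); exists x; rewrite inE phix.
have V_eq i j x : x \in V i -> x \in V j -> i = j.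
  by rewrite !inE => /eqP xi /eqP xj; apply: enum_val_inj; rewrite -xi -xj.
exists V; split; first split.
- move=> i j eqV; have [x xVi] := V_n0 i.
  by apply: (V_eq i j x) => //; rewrite -eqV.
- apply/and3P; split.
  + apply/eqP/setP => x; rewrite inE; apply/bigcupP.
    exists (V (enum_rank (phi x))); first exact: imset_f.
    by rewrite inE enum_rankK.
  + apply/trivIsetP => _ _ /imsetP[i _ ->] /imsetP[j _ ->] neqV.
    rewrite disjoint_subset; apply/subsetP => x xVi; rewrite inE.
    by apply: contra neqV => xVj; rewrite (V_eq i j x).
  + apply/imsetP => -[i _ V0]; have [x] := V_n0 i.
    by rewrite -V0 inE.
- move=> i u v; rewrite !inE => /eqP ui /eqP vi.
  by rewrite -phi_adj ui vi adj_irr.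
exists (fun i => enum_val i); first exact: enum_val_bij.
move=> i j; apply/idP/idP => [ij_adj | /andP[_]].
  apply/andP; split.
    by apply: contraTneq ij_adj => ->; rewrite adj_irr.
  have [[u uVi] [v vVj]] := (V_n0 i, V_n0 j).
  apply/exists_inP; exists u => //; apply/exists_inP; exists v => //.
  by move: uVi vVj; rewrite !inE -phi_adj => /eqP-> /eqP->.
case/exists_inP=> u uVi /exists_inP[v vVj].
by move: uVi vVj; rewrite !inE -phi_adj => /eqP-> /eqP->.
Qed.

Section Support.
Variables (I : finType) (R : I -> finComPzRingType).

Definition coordinate (x : prod_ring R) : forall i, R i :=
  fun_of_fin (x : {dffun forall i, R i}).

Definition support (x : prod_ring R) : {set I} := [set i | coordinate x i != 0].

Definition indicator (A : {set I}) : prod_ring R :=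
  [ffun i => (i \in A)%:R] : {dffun forall i, R i}.

Lemma support_eq0 x : (support x == set0) = (x == 0).
Proof.
apply/eqP/eqP => [/setP x0 | ->].
  apply/ffunP => i; rewrite ffunE; apply/eqP.
  by have := x0 i; rewrite !inE => /negbFE.
by apply/setP => i; rewrite !inE /coordinate ffunE eqxx.
Qed.

Hypothesis domR : forall i (x y : R i), (x * y == 0) = (x == 0) || (y == 0).
Hypothesis nzR : forall i, (1 : R i) != 0.

Lemma supportM x y : support (x * y) = support x :&: support y.
Proof. by apply/setP => i; rewrite !inE /coordinate ffunE domR negb_or. Qed.

Lemma support_indicator A : support (indicator A) = A.
Proof.
apply/setP => i; rewrite inE /coordinate ffunE.
by case: (i \in A); rewrite ?nzR ?eqxx.
Qed.

Lemma zero_divisor_support x : zero_divisor x = (support x != setT).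
Proof.
apply/existsP/idP => [[y /andP[]] | x_nT].
  rewrite -!support_eq0 supportM => y0.
  by apply: contraTneq => ->; rewrite setTI.
(* The complementary idempotent annihilates [x], and it is non-zero because the support of [x] is
   proper. *)
exists (indicator (~: support x)); rewrite -!support_eq0 supportM.
by rewrite support_indicator setICr eqxx -setCT (inj_eq (@setC_inj _)) x_nT.
Qed.

Lemma zdvertexE x : (x != 0) && zero_divisor x =
  (support x != set0) && (support x != setT).
Proof. by rewrite zero_divisor_support support_eq0. Qed.

Lemma zdadj_support (u v : zdvertex (prod_ring R)) :
  zdadj u v = (support (val u) :&: support (val v) == set0).
Proof.
rewrite /zdadj -support_eq0 supportM andb_idl //.
(* Disjoint supports already force [u != v]: a set disjoint from itself is empty, whereas a vertex
   is non-zero. *)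
have /andP[u0 _] := valP u; apply: contraTneq => <-.
by rewrite setIid support_eq0.
Qed.

End Support.

(** Being a vertex and being adjacent are both conditions on supports, which [indicator] carries
    over unchanged. The two families are kept symmetric so that the lemma can be applied in both
    directions. *)
Lemma zero_divisor_graph_push (I : finType) (R S : I -> finComPzRingType) :
    (forall i (x y : R i), (x * y == 0) = (x == 0) || (y == 0)) ->
    (forall i, (1 : R i) != 0) ->
    (forall i (x y : S i), (x * y == 0) = (x == 0) || (y == 0)) ->
    (forall i, (1 : S i) != 0) ->
  exists phi : zero_divisor_graph (prod_ring R) ->
               zero_divisor_graph (prod_ring S),
    (forall u, val (phi u) = indicator S (support (val u))) /\
    (forall u v, adj (phi u) (phi v) = adj u v).
Proof.
move=> domR nzR domS nzS.
have phiP (u : zdvertex (prod_ring R)) :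
    let x := indicator S (support (val u)) in (x != 0) && zero_divisor x.
  by rewrite /= zdvertexE // support_indicator // -zdvertexE //; exact: (valP u).
exists (fun u => exist _ (indicator S (support (val u))) (phiP u)).
  split=> [u | u v] //.
by rewrite /= !zdadj_support //= !support_indicator.
Qed.

Lemma Z2_mul_eq0 (x y : 'Z_2) : (x * y == 0) = (x == 0) || (y == 0).
Proof. by case: x y => [[|[|//]] ?] [[|[|//]] ?]. Qed.

(** In ['Z_2] the only non-zero value is 1, so the support determines the element. *)
Lemma indicator_support_Z2 (I : finType) (x : prod_ring (fun _ : I => 'Z_2)) :
  indicator _ (support x) = x.
Proof.
apply/ffunP => i; rewrite ffunE inE /coordinate.
by case: (fun_of_fin _ i) => [[|[|//]] ?]; apply: val_inj.
Qed.

Lemma card_zero_divisor_graph_Z2 (n : nat) : (0 < n)%N ->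
  #|zero_divisor_graph (prod_ring (fun _ : 'I_n => 'Z_2))| = (2 ^ n - 2)%N.
Proof.
move=> n_gt0; pose Z2 (_ : 'I_n) : finComPzRingType := 'Z_2.
pose D : {set {set 'I_n}} := [set set0; setT].
(* Positivity of [n] separates the empty support from the full one, so exactly two subsets are
   excluded. *)
have cardD : #|D| = 2.
  rewrite cards2; suff -> : set0 != [set: 'I_n] by [].
  by apply/eqP => /setP/(_ (Ordinal n_gt0)); rewrite !inE.
have supp_inj : injective (@support _ Z2).
  exact: can_inj (@indicator_support_Z2 _).
rewrite card_sig -(card_image supp_inj).
transitivity #|~: D|; last first.
  rewrite cardsCs setCK cardD -cardsT -powersetT.
  by rewrite card_powerset cardsT card_ord.
(* Writing [A] as the support of its indicator turns the condition on subsets into the vertex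
   condition on ring elements. *)
apply: eq_card => A; rewrite !inE negb_or -{2 3}(@support_indicator _ Z2 _ A) //.
rewrite -zdvertexE //; last by move=> i; exact: Z2_mul_eq0.
by rewrite -{1}(@support_indicator _ Z2 _ A) // mem_image.
Qed.

Theorem proposition16 (n : nat) (hn : (1 <= n)%N) (q : 'I_n -> nat)
    (F : 'I_n -> finFieldType) (hF : forall i, #|F i| = q i)
    (G : sgraph)
    (hG : graph_iso G (zero_divisor_graph (prod_ring (fun i : 'I_n => F i)))) :
  exists V : 'I_(2 ^ n - 2) -> {set G},
    partite_sets V /\
    graph_iso (partite_truncation V)
              (zero_divisor_graph (prod_ring (fun _ : 'I_n => 'Z_2))).
Proof.
case: hG => f [g fK gK] f_adj.
pose Z2 (_ : 'I_n) : finComPzRingType := 'Z_2.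
pose RF (i : 'I_n) : finComPzRingType := F i.
have domF i (x y : RF i) : (x * y == 0) = (x == 0) || (y == 0).
  exact: (@mulf_eq0 (F i)).
have nzF i : (1 : RF i) != 0 by exact: (@oner_neq0 (F i)).
have domZ i (x y : Z2 i) : (x * y == 0) = (x == 0) || (y == 0).
  exact: Z2_mul_eq0.
have nzZ i : (1 : Z2 i) != 0 by [].
have [phi [phiE phi_adj]] := zero_divisor_graph_push domF nzF domZ nzZ.
(* The push in the opposite direction is a section of [phi]: going to the fields and back keeps the
   support, hence the 0/1 vector. *)
have [psi [psiE _]] := zero_divisor_graph_push domZ nzZ domF nzF.
apply: (partite_of_surjection (phi := phi \o f)).
- exact: card_zero_divisor_graph_Z2.
- move=> y; exists (g (psi y)); rewrite /= gK; apply: val_inj.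
  by rewrite phiE psiE support_indicator // indicator_support_Z2.
- by move=> u v; rewrite /= -f_adj -phi_adj.
Qed.
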